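(* In the five-body problem on the hyperbolic plane $\mathcal{H}^2$ (of curvature $-1$) there exist masses $m,M,\mu>0$ and five pairwise distinct points $q_1(0),\dots,q_5(0)$ lying on a common geodesic of $\mathcal{H}^2$ with $$d(q_1(0),q_3(0))=d(q_2(0),q_3(0))\quad\text{and}\quad d(q_4(0),q_3(0))=d(q_5(0),q_3(0)),$$ such that, for the masses $m_1=m_2=m$, $m_3=M$, $m_4=m_5=\mu$, the points $q_1(0),\dots,q_5(0)$ are the initial positions of a collinear hyperbolic relative equilibrium.
   Context: Model of the hyperbolic plane. $\mathcal{H}^2$ denotes the complete, simply connected two-dimensional space of constant curvature $-1$. It is represented by the Weierstrass model $\mathbb{L}^2=\{(x,y,z)\in\mathbb{R}^3: x^2+y^2-z^2=-1,\ z>0\}$, where $\mathbb{R}^3$ carries the Lorentz inner product $a\odot b=a_xb_x+a_yb_y-a_zb_z$. The hyperbolic distance is $d(p,q)=\cosh^{-1}(-p\odot q)$. Geodesics are the nonempty intersections of $\mathbb{L}^2$ with planes through the origin of $\mathbb{R}^3$. The $n$-body problem (here $n=5$). Point particles with positive masses $m_1,\dots,m_n$ and pairwise distinct positions $q_1(t),\dots,q_n(t)\in\mathbb{L}^2$ move according to $$\ddot q_i=\sum_{j\ne i}\frac{m_j\,\bigl(q_j+(q_i\odot q_j)q_i\bigr)}{\bigl(-1+(q_i\odot q_j)^2\bigr)^{3/2}}+(\dot q_i\odot\dot q_i)\,q_i,\qquad i=1,\dots,n.$$ Hyperbolic relative equilibria. Let $\mathrm{Lor}(\mathbb{L}^2,\odot)$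 be the group of linear transformations of $\mathbb{R}^3$ of determinant $1$ that preserve $\odot$ and map $\mathbb{L}^2$ to itself. For $s\in\mathbb{R}$ let $$A(s)=\begin{pmatrix}1&0&0\\0&\cosh s&\sinh s\\0&\sinh s&\cosh s\end{pmatrix}.$$ A hyperbolic relative equilibrium is a solution of the equations of motion of the form $q_i(t)=P\,A(\omega t)\,P^{-1}q_i(0)$ for all $t\in\mathbb{R}$ and all $i=1,\dots,n$, for some $P\in\mathrm{Lor}(\mathbb{L}^2,\odot)$ and some constant $\omega\neq 0$ (the same $P$ and $\omega$ for all $i$). It is called collinear if at each time all the particles lie on the same geodesic. *)

(* Defs.v *)
From mathcomp Require Import all_boot all_order all_algebra.
From mathcomp Require Import all_classical all_reals all_analysis.
From mathcomp Require Import ring lra.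

Set Implicit Arguments.
Unset Strict Implicit.
Unset Printing Implicit Defensive.

Import Order.TTheory GRing.Theory Num.Theory.
Import numFieldNormedType.Exports.

Local Open Scope classical_set_scope.
Local Open Scope ring_scope.

Definition cosh (R : realType) (x : R) : R := (expR x + expR (- x)) / 2.
Definition sinh (R : realType) (x : R) : R := (expR x - expR (- x)) / 2.

(* The nonnegative inverse of cosh; only meaningful on [1, +oo), see arcoshP. *)
Definition arcosh (R : realType) (x : R) : R :=
  get [set y : R | 0 <= y /\ cosh y = x].

Lemma arcoshP (R : realType) (x : R) :
  1 <= x -> 0 <= arcosh x /\ cosh (arcosh x) = x.
Proof.
move=> x1; apply: (@xgetPex _ _ [set y : R | 0 <= y /\ cosh y = x]).
pose s := Num.sqrt (x ^+ 2 - 1).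
have s0 : 0 <= s by exact: sqrtr_ge0.
have s2 : s ^+ 2 = x ^+ 2 - 1 by rewrite sqr_sqrtr //; nra.
have u0 : 0 < x + s by lra.
exists (ln (x + s)); split; first by apply: ln_ge0; lra.
rewrite /cosh expRN lnK ?posrE //.
have -> : (x + s)^-1 = x - s.
  apply: (mulfI (lt0r_neq0 u0)); rewrite mulfV ?lt0r_neq0 //.
  have -> : (x + s) * (x - s) = x ^+ 2 - s ^+ 2 by ring.
  by rewrite s2; ring.
by field.
Qed.

(* The rows 0, 1, 2 : 'I_3 of a column vector are the coordinates x, y, z. *)
Definition lorentz (R : realType) (a b : 'cV[R]_3) : R :=
  a 0 0 * b 0 0 + a 1 0 * b 1 0 - a 2%:R 0 * b 2%:R 0.

Definition weierstrass (R : realType) : set 'cV[R]_3 :=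
  [set p | p 0 0 ^+ 2 + p 1 0 ^+ 2 - p 2%:R 0 ^+ 2 = -1 /\ 0 < p 2%:R 0].

Definition hdist (R : realType) (p q : 'cV[R]_3) : R := arcosh (- lorentz p q).

(* The plane through the origin is given by a nonzero (Euclidean) normal. *)
Definition geodesic (R : realType) (G : set 'cV[R]_3) : Prop :=
  G !=set0 /\
  exists nu : 'rV[R]_3, nu != 0 /\ G = weierstrass (R:=R) `&` [set p | nu *m p = 0].

Definition on_common_geodesic (R : realType) (I : Type) (p : I -> 'cV[R]_3) :
    Prop :=
  exists G : set 'cV[R]_3, geodesic G /\ forall i, G (p i).

Definition Lor (R : realType) : set 'M[R]_3 :=
  [set P | [/\ \det P = 1,
               forall a b : 'cV[R]_3, lorentz (P *m a) (P *m b) = lorentz a b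
             & [set P *m p | p in weierstrass (R:=R)] = weierstrass (R:=R)]].

Definition hyp_rot (R : realType) (s : R) : 'M[R]_3 :=
  \matrix_(i, j) nth 0 (nth [::] [:: [:: 1; 0; 0];
                                     [:: 0; cosh s; sinh s];
                                     [:: 0; sinh s; cosh s]] i) j.

Definition nbody_solution (R : realType) (n : nat) (m : 'I_n -> R)
    (q : 'I_n -> R -> 'cV[R]_3) : Prop :=
  [/\ forall i t, weierstrass (q i t),
      forall t, injective (fun i => q i t),
      forall i t, derivable (q i) t 1,
      forall i t, derivable (derive1 (q i)) t 1
    & forall i t,
        derive1 (derive1 (q i)) t =
          \sum_(j < n | j != i)
             (m j / (-1 + lorentz (q i t) (q j t) ^+ 2) `^ (3 / 2)) *:
               (q j t + lorentz (q i t) (q j t) *: q i t)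
          + lorentz (derive1 (q i) t) (derive1 (q i) t) *: q i t].

Definition hyperbolic_RE (R : realType) (n : nat) (m : 'I_n -> R)
    (q : 'I_n -> R -> 'cV[R]_3) : Prop :=
  nbody_solution m q /\
  exists (P : 'M[R]_3) (omega : R),
    [/\ Lor P, omega != 0
      & forall i t, q i t = P *m hyp_rot (omega * t) *m invmx P *m q i 0].

Definition collinear (R : realType) (n : nat) (q : 'I_n -> R -> 'cV[R]_3) :
    Prop :=
  forall t, on_common_geodesic (fun i => q i t).

(* Main.v *)
Require Import Defs.
From mathcomp Require Import all_boot all_order all_algebra.
From mathcomp Require Import all_classical all_reals all_analysis.
From mathcomp Require Import ring lra.
Import Order.TTheory GRing.Theory Num.Theory.
Import numFieldNormedType.Exports.
Local Open Scope ring_scope.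

(** Let five particles lie on a geodesic orthogonal to the axis of a hyperbolic
    translation, at signed distances [a, -a, 0, b, -b] from the axis, where
    [0 < a < b], and let the translation carry them along.  All particles then
    stay on one geodesic, the moving perpendicular to the axis, so only the
    equations of motion are at stake.

    For any number of particles placed at signed distances [a i] in this way,
    both the attractions and the covariant acceleration of particle [i] are
    multiples of the unit tangent to the moving perpendicular.  Hence the
    equations of motion no longer involve time and reduce to one scalar
    equation per particle, called [balanced] below:
      sum over j <> i of m_j sinh(a_j - a_i) / |sinh(a_j - a_i)|^3
        = - w^2 sinh(a_i) cosh(a_i).
    This is [balanced_nbody], and [balanced_hyperbolic_RE] turns it into a
    relative equilibrium.

    In the symmetric configuration with masses [m, m, M, mu, mu] the equation
    at the centre holds by symmetry, and those at [-a] and [-b] mirror those at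
    [a] and [b].  Two equations remain, linear in the masses:
      M / sinh^2 a + m / sinh^2 2a - mu (1/sinh^2 (b-a) - 1/sinh^2 (b+a))
        = w^2 sinh a cosh a,
      M / sinh^2 b + m (1/sinh^2 (b-a) + 1/sinh^2 (b+a)) + mu / sinh^2 2b
        = w^2 sinh b cosh b.
    For [m = 0] Cramer's rule gives positive [M] and [mu], the latter because
    [1/sinh^2 a > 1/sinh^2 b] while [sinh a cosh a < sinh b cosh b]; by
    continuity this persists for small [m > 0].  [positive_masses] makes this
    explicit, so that suitable masses exist for all [0 < a < b] and [w <> 0]
    ([symmetric_five_body_balance]). *)

(** * Hyperbolic functions *)

Section Hyperbolic.
Context {R : realType}.
Implicit Types x y a b w t : R.

Lemma cosh_sqr x : cosh x ^+ 2 = 1 + sinh x ^+ 2.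
Proof.
rewrite /cosh /sinh; have : expR x * expR (- x) = 1 by rewrite -expRD subrr expR0.
by move=> e; field: e.
Qed.

Lemma coshN x : cosh (- x) = cosh x.
Proof. by rewrite /cosh opprK addrC. Qed.

Lemma sinhN x : sinh (- x) = - sinh x.
Proof. by rewrite /sinh opprK; field. Qed.

Lemma sinh0 : sinh (0 : R) = 0.
Proof. by rewrite /sinh oppr0 subrr mul0r. Qed.

Lemma cosh0 : cosh (0 : R) = 1.
Proof. by rewrite /cosh oppr0 expR0; field. Qed.

Lemma sinhB x y : sinh (x - y) = sinh x * cosh y - cosh x * sinh y.
Proof. by rewrite /sinh /cosh opprB !expRD; field. Qed.

Lemma coshB x y : cosh (x - y) = cosh x * cosh y - sinh x * sinh y.
Proof. by rewrite /sinh /cosh opprB !expRD; field. Qed.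

Lemma sinh_double x : sinh (x + x) = 2 * (sinh x * cosh x).
Proof. by rewrite -{2}[x]opprK sinhB coshN sinhN; ring. Qed.

Lemma cosh_gt0 x : 0 < cosh x.
Proof. by rewrite /cosh; have := expR_gt0 x; have := expR_gt0 (- x); lra. Qed.

Lemma ltr_sinh x y : x < y -> sinh x < sinh y.
Proof.
move=> xy; have : expR x < expR y by rewrite ltr_expR.
have : expR (- y) < expR (- x) by rewrite ltr_expR ltrN2.
by rewrite /sinh; lra.
Qed.

Lemma sinh_inj : injective (@sinh R).
Proof.
by move=> x y e; case: (ltgtP x y) => // /ltr_sinh; rewrite e ltxx.
Qed.

Lemma sinh_gt0 x : 0 < x -> 0 < sinh x.
Proof. by move=> /ltr_sinh; rewrite sinh0. Qed.

Lemma is_derive_sinh_lin w t :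
  is_derive t 1 (fun u => sinh (w * u)) (w * cosh (w * t)).
Proof.
apply: is_derive_eq; rewrite /cosh /GRing.scale /=; by field.
Qed.

Lemma is_derive_cosh_lin w t :
  is_derive t 1 (fun u => cosh (w * u)) (w * sinh (w * t)).
Proof.
apply: is_derive_eq; rewrite /sinh /GRing.scale /=; by field.
Qed.

(** * Curves in Lorentz space *)

Definition col3 x y z : 'cV[R]_3 := \col_k nth 0 [:: x; y; z] k.

Lemma col3E x y z :
  (col3 x y z 0 0 = x) * (col3 x y z 1 0 = y) * (col3 x y z 2%:R 0 = z).
Proof. by rewrite !mxE. Qed.

Lemma col3P (u v : 'cV[R]_3) :
  u 0 0 = v 0 0 -> u 1 0 = v 1 0 -> u 2%:R 0 = v 2%:R 0 -> u = v.
Proof.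
move=> e0 e1 e2; apply/colP => -[[|[|[|//]]] k3].
- by have -> : Ordinal k3 = 0 by exact: val_inj.
- by have -> : Ordinal k3 = 1 by exact: val_inj.
- by have -> : Ordinal k3 = 2%:R by exact: val_inj.
Qed.

Lemma is_derive_col3 (f g h : R -> R) t df dg dh :
  is_derive t 1 f df -> is_derive t 1 g dg -> is_derive t 1 h dh ->
  is_derive t 1 (fun u => col3 (f u) (g u) (h u)) (col3 df dg dh).
Proof.
move=> Df Dg Dh.
have E (i : 'I_3) (F : R -> R) : (forall u, nth 0 [:: f u; g u; h u] i = F u) ->
    (fun u => col3 (f u) (g u) (h u) i 0) = F.
  by move=> EF; apply/funext => u; rewrite mxE EF.
have D : derivable (fun u => col3 (f u) (g u) (h u)) t 1.
  apply/derivable_mxP => -[[|[|[|//]]] k3] j; rewrite ord1.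
  - by rewrite (E _ f) //; exact: ex_derive.
  - by rewrite (E _ g) //; exact: ex_derive.
  - by rewrite (E _ h) //; exact: ex_derive.
split=> //; rewrite derive_mx //; apply: col3P; rewrite !mxE /=.
- by rewrite (E _ f) // derive_val.
- by rewrite (E _ g) // derive_val.
- by rewrite (E _ h) // derive_val.
Qed.

(** * Points at given distance from the axis of translation *)

(** The Lorentz transformations [hyp_rot t] translate along the geodesic x = 0.
    [pt a t] lies at signed distance [a] from this axis, on the geodesic that
    crosses it at right angles at abscissa [t]. *)
Definition pt a t : 'cV[R]_3 :=
  col3 (sinh a) (cosh a * sinh t) (cosh a * cosh t).

Lemma lorentz_pt a b t : lorentz (pt a t) (pt b t) = - cosh (a - b).
Proof.
by rewrite /lorentz !col3E coshB; have := cosh_sqr t => e; ring: e.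
Qed.

Lemma weierstrass_pt a t : weierstrass (pt a t).
Proof.
split; rewrite !col3E; last by rewrite mulr_gt0 // cosh_gt0.
by have ea := cosh_sqr a; have et := cosh_sqr t; ring: ea et.
Qed.

Lemma pt_inj t : injective (pt ^~ t).
Proof.
by move=> a b /(congr1 (fun v : 'cV_3 => v 0 0)); rewrite !col3E => /sinh_inj.
Qed.

(** The vector [q_j + (q_i . q_j) q_i] of the force law is tangent at [q_i] to
    the geodesic through both points; for two points of one perpendicular, the
    unit tangent is the derivative of [pt a t] in [a]. *)
Lemma force_pt a b t :
  pt b t + lorentz (pt a t) (pt b t) *: pt a t =
  sinh (b - a) *: col3 (cosh a) (sinh a * sinh t) (sinh a * cosh t).
Proof.
have ea := cosh_sqr a.
rewrite lorentz_pt coshB sinhB; by apply: col3P; rewrite !mxE /=; ring: ea.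
Qed.

(** Here [q_i . q_j] is minus the hyperbolic cosine of the distance, so
    [(q_i . q_j)^2 - 1] is the square of its hyperbolic sine. *)
Lemma force_denom a b t :
  (-1 + lorentz (pt a t) (pt b t) ^+ 2) `^ (3 / 2) = `|sinh (b - a)| ^+ 3.
Proof.
have -> : -1 + lorentz (pt a t) (pt b t) ^+ 2 = `|sinh (b - a)| `^ 2.
  rewrite powR_mulrn // real_normK ?num_real //.
  by rewrite lorentz_pt sqrrN -coshN opprB cosh_sqr; ring.
by rewrite -powRrM (_ : 2 * (3 / 2) = 3) ?powR_mulrn //; field.
Qed.

Lemma hyp_rot_pt a t : hyp_rot t *m pt a 0 = pt a t.
Proof.
by apply: col3P; rewrite !mxE !big_ord_recl big_ord0 !mxE /= sinh0 cosh0; ring.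
Qed.

Lemma is_derive_pt a w t :
  is_derive t 1 (fun u => pt a (w * u))
    (col3 0 (cosh a * (w * cosh (w * t))) (cosh a * (w * sinh (w * t)))).
Proof.
apply: is_derive_col3.
- exact/is_deriveZ/is_derive_sinh_lin.
- exact/is_deriveZ/is_derive_cosh_lin.
Qed.

Lemma is_derive2_pt a w t :
  is_derive t 1 (fun u =>
      col3 0 (cosh a * (w * cosh (w * u))) (cosh a * (w * sinh (w * u))))
    (col3 0 (cosh a * (w * (w * sinh (w * t))))
            (cosh a * (w * (w * cosh (w * t))))).
Proof.
apply: is_derive_col3.
- exact/is_deriveZ/is_deriveZ/is_derive_cosh_lin.
- exact/is_deriveZ/is_deriveZ/is_derive_sinh_lin.
Qed.

(** * Reduction of the equations of motion to scalar equations *)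

(** The tangential component, at the point at signed distance [a], of the
    attraction by a mass [m] at signed distance [b]. *)
Definition attraction m a b := m * sinh (b - a) / `|sinh (b - a)| ^+ 3.

Definition balanced {n : nat} (m a : 'I_n -> R) w :=
  forall i, \sum_(j < n | j != i) attraction (m j) (a i) (a j) =
            - (w ^+ 2 * (sinh (a i) * cosh (a i))).

Section Family.
Variables (n : nat) (m a : 'I_n -> R) (w : R).
Hypotheses (a_inj : injective a).

Let q i t := pt (a i) (w * t).

(** The moving perpendicular is cut out by a plane whose normal is the Lorentz
    dual of the velocity of the point where it meets the axis. *)
Lemma collinear_pt : collinear q.
Proof.
move=> t; exists (@weierstrass R `&`
  [set p | (col3 0 (cosh (w * t)) (- sinh (w * t)))^T *m p = 0])%classic.
have in_plane b :
    (col3 0 (cosh (w * t)) (- sinh (w * t)))^T *m pt b (w * t) = 0.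
  apply/matrixP => i j; rewrite !ord1 !mxE !big_ord_recl big_ord0 !mxE /=; by ring.
split=> [|i]; last by split; [exact: weierstrass_pt | exact: in_plane].
split; first by exists (pt 0 (w * t)); split; [exact: weierstrass_pt|exact: in_plane].
exists (col3 0 (cosh (w * t)) (- sinh (w * t)))^T; split => //.
apply/eqP => /matrixP /(_ 0 1); rewrite mxE col3E mxE => e.
by have := cosh_gt0 (w * t); rewrite e ltxx.
Qed.

(** With [c = cosh (a i)] and [s = sinh (a i)], removing the radial term
    [w^2 c^2 q] from the acceleration leaves [- w^2 s c] times the unit tangent
    of [force_pt]. *)
Lemma balanced_nbody : balanced m a w -> nbody_solution m q.
Proof.
move=> bal.
have dq i : derive1 (q i) = fun t => col3 0
    (cosh (a i) * (w * cosh (w * t))) (cosh (a i) * (w * sinh (w * t))).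
  by apply/funext => t; rewrite derive1E; case: (is_derive_pt (a i) w t).
split.
- by move=> i t; exact: weierstrass_pt.
- by move=> t i j /pt_inj /a_inj.
- by move=> i t; case: (is_derive_pt (a i) w t).
- by move=> i t; rewrite dq; case: (is_derive2_pt (a i) w t).
move=> i t; rewrite dq derive1E; case: (is_derive2_pt (a i) w t) => _ ->.
under eq_bigr do rewrite force_denom force_pt scalerA mulrAC.
rewrite -scaler_suml bal.
have ea := cosh_sqr (a i); have et := cosh_sqr (w * t).
by apply: col3P; rewrite /lorentz !mxE /=; ring: ea et.
Qed.

Lemma balanced_hyperbolic_RE : w != 0 -> balanced m a w -> hyperbolic_RE m q.
Proof.
move=> w0 bal; split; first exact: balanced_nbody.
(* the axis of [hyp_rot] is the axis of [pt], so no conjugation occurs *)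
exists 1%:M, w; split => //.
  split; first by rewrite det1.
    by move=> u v; rewrite !mul1mx.
  by apply/seteqP; split => [_ [p Wp <-]|p Wp];
    [rewrite mul1mx | exists p; rewrite ?mul1mx].
move=> i t; rewrite invmx1 mulmx1 mul1mx /q.
by rewrite mulr0 hyp_rot_pt.
Qed.

End Family.

(** * Masses balancing the symmetric five-body configuration *)

Lemma attraction_right m a b :
  a < b -> attraction m a b = m * sinh (b - a) ^- 2.
Proof.
rewrite -subr_gt0 => /sinh_gt0 s0; rewrite /attraction gtr0_norm //.
by have := lt0r_neq0 s0 => /eqP s1; field; apply/eqP.
Qed.

Lemma attraction_left m a b :
  a < b -> attraction m b a = - (m * sinh (b - a) ^- 2).
Proof.
move=> ab; rewrite -(attraction_right m a b ab) /attraction -(opprB b a).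
by rewrite sinhN normrN mulrN mulNr.
Qed.

Lemma attractionN m a b : attraction m (- a) (- b) = - attraction m a b.
Proof. by rewrite /attraction -opprD sinhN normrN mulrN mulNr. Qed.

(** For a fixed [m] this is a 2 x 2 system in [M] and [mu] with determinant
    [D > 0].  By Cramer's rule [M > 0] as soon as both right-hand sides remain
    positive once the terms in [m] are subtracted, and [mu > 0] as soon as
    [al * ta - al' * si > 0] outweighs [m * al * be'].  The first follows from
    [m * be < si] and from the second, so two bounds on [m] suffice. *)
Lemma positive_masses (al al' be be' ga ga' si ta : R) :
  0 < al' -> al' < al -> 0 < be -> 0 < be' -> 0 < ga -> 0 < ga' ->
  0 < si -> si < ta ->
  exists m M mu : R, [/\ 0 < m, 0 < M & 0 < mu] /\
    (M * al + m * be - mu * ga = si /\ M * al' + m * be' + mu * ga' = ta).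
Proof.
move=> al'0 al'al be0 be'0 ga0 ga'0 si0 sita.
have al0 : 0 < al by exact: lt_trans al'al.
have ta0 : 0 < ta by exact: lt_trans sita.
have de0 : 0 < al * ta - al' * si by nra.
pose D := al * ga' + al' * ga.
have D0 : 0 < D by rewrite addr_gt0 ?mulr_gt0.
(* half the bound makes both inequalities strict *)
pose bound := Num.min (si / be) ((al * ta - al' * si) / (al * be')).
pose m := bound / 2.
have bound0 : 0 < bound by rewrite lt_min !divr_gt0 // mulr_gt0.
have m0 : 0 < m by rewrite divr_gt0.
have m_lt : m < bound by rewrite /m; lra.
have m1 : m * be < si.
  rewrite -ltr_pdivlMr //; apply: (lt_le_trans m_lt).
  by rewrite ge_min lexx.
have m2 : al * (m * be') < al * ta - al' * si.
  rewrite mulrCA -ltr_pdivlMr ?mulr_gt0 //; apply: (lt_le_trans m_lt).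
  by rewrite ge_min lexx orbT.
have m3 : m * be' < ta by rewrite -(ltr_pM2l al0); nra.
exists m, ((ga' * (si - m * be) + ga * (ta - m * be')) / D),
  ((al * (ta - m * be') - al' * (si - m * be)) / D).
split; last by have := lt0r_neq0 D0; rewrite /D => Dn0; split; field.
split => //; rewrite divr_gt0 //.
- by rewrite addr_gt0 // mulr_gt0 // subr_gt0.
- have : 0 < al' * (m * be) by rewrite !mulr_gt0.
  by rewrite !mulrBr; lra.
Qed.

(** The linear system meets the sign conditions of [positive_masses] because
    [sinh] increases and [sinh x * cosh x] is half of [sinh (x + x)]. *)
Lemma symmetric_five_body_balance a b w : 0 < a -> a < b -> w != 0 ->
  exists m M mu : R, [/\ 0 < m, 0 < M & 0 < mu] /\
    balanced (fun i : 'I_5 => nth 0 [:: m; m; M; mu; mu] i)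
             (fun i : 'I_5 => nth 0 [:: a; - a; 0; b; - b] i) w.
Proof.
move=> a0 ab w0.
have inv_lt x y : 0 < x -> x < y -> (sinh y ^- 2 < sinh x ^- 2 :> R).
  move=> x0 xy; have sx := sinh_gt0 _ x0; have sxy := ltr_sinh _ _ xy.
  have sy := lt_trans sx sxy.
  by rewrite ltf_pV2 ?posrE ?exprn_gt0 // ltr_pXn2r // nnegrE ltW.
have inv_gt0 x : 0 < x -> 0 < sinh x ^- 2 :> R.
  by move=> /sinh_gt0 ?; rewrite invr_gt0 exprn_gt0.
have b0 : 0 < b by exact: lt_trans ab.
have w2 : 0 < w ^+ 2 by rewrite exprn_even_gt0.
have [| | | | | | | |m [M [mu [pos [eqa eqb]]]]] := positive_masses
  (sinh a ^- 2) (sinh b ^- 2) (sinh (a + a) ^- 2)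
  (sinh (b - a) ^- 2 + sinh (b + a) ^- 2)
  (sinh (b - a) ^- 2 - sinh (b + a) ^- 2) (sinh (b + b) ^- 2)
  (w ^+ 2 * (sinh a * cosh a)) (w ^+ 2 * (sinh b * cosh b)).
- exact: inv_gt0.
- exact: inv_lt.
- by apply: inv_gt0; lra.
- by rewrite addr_gt0 // inv_gt0; lra.
- by rewrite subr_gt0 inv_lt; lra.
- by apply: inv_gt0; lra.
- by rewrite mulr_gt0 // mulr_gt0 ?sinh_gt0 ?cosh_gt0.
- have aabb : a + a < b + b by lra.
  by rewrite ltr_pM2l //; have := ltr_sinh _ _ aabb; rewrite !sinh_double ltr_pM2l.
exists m, M, mu; split => //.
have eq_a : attraction m a (- a) + attraction M a 0 + attraction mu a b
    + attraction mu a (- b) = - (w ^+ 2 * (sinh a * cosh a)).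
  rewrite (attraction_left m (- a)) ?(attraction_left M 0)
    ?(attraction_right mu a b) ?(attraction_left mu (- b)) //; [|lra..].
  by rewrite !opprK subr0 [a + b]addrC -eqa; ring.
have eq_b : attraction m b a + attraction m b (- a) + attraction M b 0
    + attraction mu b (- b) = - (w ^+ 2 * (sinh b * cosh b)).
  rewrite !(attraction_left _ _ b) //; [|lra..].
  by rewrite !opprK subr0 -eqb; ring.
have attractionNl k x y : attraction k (- x) y = - attraction k x (- y).
  by rewrite -attractionN opprK.
have attraction0N k x : attraction k 0 (- x) = - attraction k 0 x.
  by rewrite -attractionN oppr0.
move=> [[|[|[|[|[|//]]]]] i5]; rewrite big_mkcond !big_ord_recl big_ord0 /=.
- by rewrite -eq_a; ring.
- by rewrite !attractionNl oppr0 !opprK sinhN coshN mulNr mulrN -eq_a; ring.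
- by rewrite !attraction0N sinh0; ring.
- by rewrite -eq_b; ring.
- by rewrite !attractionNl oppr0 !opprK sinhN coshN mulNr mulrN -eq_b; ring.
Qed.
End Hyperbolic.

(** * The relative equilibrium *)

Theorem theorem5 (R : realType) :
  exists m M mu : R,
    [/\ 0 < m, 0 < M & 0 < mu] /\
  exists q1 q2 q3 q4 q5 : 'cV[R]_3,
    let q0 := fun i : 'I_5 => nth 0 [:: q1; q2; q3; q4; q5] i in
    let mass := fun i : 'I_5 => nth 0 [:: m; m; M; mu; mu] i in
    [/\ injective q0,
        on_common_geodesic q0,
        hdist q1 q3 = hdist q2 q3,
        hdist q4 q3 = hdist q5 q3
      & exists q : 'I_5 -> R -> 'cV[R]_3,
          [/\ forall i, q i 0 = q0 i, hyperbolic_RE mass q & collinear q]].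
Proof.
have [//||//|m [M [mu [pos bal]]]] := symmetric_five_body_balance (R := R) 1 2 1.
  by lra.
(* any distances [0 < a < b] would do; here [a = 1], [b = 2] and [w = 1] *)
exists m, M, mu; split => //.
exists (pt 1 0), (pt (-1) 0), (pt 0 0), (pt 2 0), (pt (-2) 0) => q0 mass.
pose a (i : 'I_5) : R := nth 0 [:: 1; -1; 0; 2; -2] i.
have a_inj : injective a.
  move=> [[|[|[|[|[|//]]]]] i5] [[|[|[|[|[|//]]]]] j5]; rewrite /a /= => e;
    by [exact: val_inj | exfalso; lra].
have q0E : q0 = fun i => pt (a i) 0.
  by apply/funext => -[[|[|[|[|[|//]]]]] i5].
have coll := collinear_pt _ a 1.
split.
- by rewrite q0E => i j /pt_inj /a_inj.
- by have := coll 0; rewrite q0E mulr0.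
- by rewrite /hdist !lorentz_pt !subr0 coshN.
- by rewrite /hdist !lorentz_pt !subr0 coshN.
exists (fun i t => pt (a i) (1 * t)); split => //.
- by move=> i; rewrite mulr0 q0E.
- exact: balanced_hyperbolic_RE.
Qed.
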